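(* Let $(\Omega,\mu,(\Pi_0,\Pi_1))$ be an information structure with $|\Omega|<\infty$ and let $C\subseteq\Omega$ be any event. Let $\mathcal{F}=\{E_1',\ldots,E_n'\}$ be the set of maximally evident $C$-indicating events of $\Omega$, i.e. the set of events $E_i'$ for which there exists some $F\subseteq\Omega$ such that $E_i'$ is the maximally evident $C$-indicating superset of $F$. Then $\mathcal{F}$ can be ordered into a nested sequence of strict subsets $E_1\supset E_2\supset\cdots\supset E_n$ such that, for every $i>1$, $E_i$ is the largest super-evident $C$-indicating subset of $E_{i-1}$.
   Context: An information structure $(\Omega,\mu,(\Pi_0,\Pi_1))$ consists of a finite set $\Omega$ of states, a probability measure $\mu$ on $\Omega$, and two partitions $\Pi_0,\Pi_1$ of $\Omega$ (one per player $i\in\{0,1\}$). $\Pi_i(\omega)$ is the cell of $\Pi_i$ containing $\omega$; every cell is assumed to have positive $\mu$-measure. Events are subsets of $\Omega$. Put $P_i(E\mid\omega)=\mu(E\cap\Pi_i(\omega))/\mu(\Pi_i(\omega))$. All $p$ range over $[0,1]$. Given an event $C$: $E$ is a $p$-evident $C$-indicating event if for all $\omega\in E$ and all players $i$, $P_i(E\mid\omega)\ge p$ and $P_i(C\mid\omega)\ge p$. $E$ is a super-$p$-evident $C$-indicating event if for all $\omega\in E$ and all $i$, $P_i(E\mid\omega)>p$ and $P_i(C\mid\omega)>p$. $E$ is the largest $p$-evident $C$-indicating event if $E$ is a $p$-evident $C$-indicating event and every $p$-evident $C$-indicating event is a subset of $E$. The $C$-evidence level of $E$ is the maximum $p\in[0,1]$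 for which $E$ is a $p$-evident $C$-indicating event (so the empty event has level $1$). $E$ is the maximally evident $C$-indicating superset of $F$ if $F\subseteq E$ and, with $p$ the $C$-evidence level of $E$, $E$ is the largest $p$-evident $C$-indicating event and every event $G\supseteq F$ has $C$-evidence level at most $p$. $E$ is the largest super-evident $C$-indicating subset of $F$ if $E\subseteq F$ and, with $p$ the $C$-evidence level of $F$, $E$ is a super-$p$-evident $C$-indicating event, and every event $G\subseteq F$ with $C$-evidence level greater than $p$ satisfies $G\subseteq E$. *)

(* Defs.v *)
From HB Require Import structures.
From mathcomp Require Import all_boot all_order all_algebra.

Set Implicit Arguments.
Unset Strict Implicit.
Unset Printing Implicit Defensive.

Import Order.TTheory GRing.Theory Num.Theory.
Local Open Scope ring_scope.

(* The measure on the finite state space is given by its point masses. *)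
Record info_structure (R : realFieldType) (Omega : finType) := InfoStructure {
  mass : Omega -> R;
  mass_ge0 : forall w, 0 <= mass w;
  mass_sum1 : \sum_w mass w = 1;
  info : 'I_2 -> {set {set Omega}};
  info_partition : forall i, partition (info i) [set: Omega];
  info_gt0 : forall i B, B \in info i -> 0 < \sum_(w in B) mass w
}.

Section Evidence.
Variables (R : realFieldType) (Omega : finType) (S : info_structure R Omega).
Implicit Types (C E F G : {set Omega}) (w : Omega) (i : 'I_2) (p q : R).

Definition measure E : R := \sum_(w in E) mass S w.

Definition cell i w : {set Omega} := pblock (info S i) w.

Definition posterior i E w : R := measure (E :&: cell i w) / measure (cell i w).

Definition evident C p E : Prop :=
  forall w, w \in E -> forall i, p <= posterior i E w /\ p <= posterior i C w.

Definition super_evident C p E : Prop :=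
  forall w, w \in E -> forall i, p < posterior i E w /\ p < posterior i C w.

Definition largest_evident C p E : Prop :=
  evident C p E /\ forall G, evident C p G -> G \subset E.

(* [evidence_level C E p]: p is the maximum of the set of levels in [0, 1] at
   which E is evident.  This relation is functional and total in p: see
   [evidence_level_uniq] and [evidence_level_exists] below. *)
Definition evidence_level C E p : Prop :=
  [/\ 0 <= p <= 1, evident C p E &
      forall q, 0 <= q <= 1 -> evident C q E -> q <= p].

(* In the next two definitions, F is the reference event: E is the maximally
   evident superset, resp. the largest super-evident subset, of F. *)
Definition max_evident_superset C F E : Prop :=
  F \subset E /\
  exists p, [/\ evidence_level C E p, largest_evident C p E &
    forall G q, F \subset G -> evidence_level C G q -> q <= p].

Definition largest_super_evident_subset C F E : Prop :=
  E \subset F /\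
  exists p, [/\ evidence_level C F p, super_evident C p E &
    forall G q, G \subset F -> evidence_level C G q -> p < q -> G \subset E].

Definition max_evident_event C E : Prop :=
  exists F, max_evident_superset C F E.

Lemma evidence_level_uniq C E p q :
  evidence_level C E p -> evidence_level C E q -> p = q.
Proof.
move=> [p01 Ep maxp] [q01 Eq maxq].
by apply/eqP; rewrite eq_le maxq // maxp.
Qed.

Lemma measure_ge0 E : 0 <= measure E.
Proof. by apply: sumr_ge0 => w _; apply: mass_ge0. Qed.

Lemma posterior_ge0 i E w : 0 <= posterior i E w.
Proof. by apply: divr_ge0; apply: measure_ge0. Qed.

Lemma evidence_level_exists C E : exists p, evidence_level C E p.
Proof.
pose f (x : Omega * 'I_2) :=
  Num.min (posterior x.2 E x.1) (posterior x.2 C x.1).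
exists (\big[Num.min/1]_(x | x.1 \in E) f x); split.
- rewrite bigmin_le_id andbT; apply: le_bigmin => // x _.
  by rewrite /f le_min !posterior_ge0.
- move=> w wE i; apply/andP; rewrite -le_min.
  exact: (@bigmin_le_cond _ _ _ _ (w, i)).
- move=> q /andP[_ q1] Eq; apply: le_bigmin => // -[w i] /= wE.
  by rewrite /f le_min; apply/andP; apply: Eq.
Qed.

End Evidence.

(* Main.v *)
(** Events evident at a fixed level are closed under union, so for every event G
    there is a largest event at least as evident as G, and it is maximally
    evident.  The maximally evident events are exactly the E that contain every
    event of level at least that of E; hence on them a larger level means a
    smaller event and equal levels mean equal events, so sorting by level gives
    a strict chain.  If G has a level exceeding that of E_(i-1), the largest
    event at least as evident as G occurs in the chain after E_(i-1), hence is
    contained in E_i. *)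
Require Import Defs.
From HB Require Import structures.
From mathcomp Require Import all_boot all_order all_algebra.

Set Implicit Arguments.
Unset Strict Implicit.
Unset Printing Implicit Defensive.

Import Order.TTheory GRing.Theory Num.Theory.
Local Open Scope ring_scope.

Lemma measure_subset (R : realFieldType) (Omega : finType)
    (S : info_structure R Omega) (E F : {set Omega}) :
  E \subset F -> measure S E <= measure S F.
Proof.
move=> sEF; rewrite /measure [leRHS](big_setID E) /= (setIidPr sEF) lerDl.
exact: (measure_ge0 S).
Qed.

Lemma posterior_subset (R : realFieldType) (Omega : finType)
    (S : info_structure R Omega) i (E F : {set Omega}) w :
  E \subset F -> posterior S i E w <= posterior S i F w.
Proof.
move=> sEF; apply: ler_wpM2r; first by rewrite invr_ge0 measure_ge0.
exact/measure_subset/setSI.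
Qed.

Lemma evident_le (R : realFieldType) (Omega : finType)
    (S : info_structure R Omega) (C E : {set Omega}) p q :
  p <= q -> evident S C q E -> evident S C p E.
Proof.
by move=> le_pq Eq w wE i; have [] := Eq w wE i; split; apply: le_trans le_pq _.
Qed.

(** At a state of [E j], passing to the union can only raise the posterior of the event, and the
    posterior of [C] does not depend on [E j] at all. *)
Lemma evident_bigcup (R : realFieldType) (Omega I : finType)
    (S : info_structure R Omega) (C : {set Omega}) p (P : pred I)
    (E : I -> {set Omega}) :
  (forall j, P j -> evident S C p (E j)) ->
  evident S C p (\bigcup_(j | P j) E j).
Proof.
move=> Ep w /bigcupP[j Pj wEj] i; have [leE leC] := Ep j Pj w wEj i.
by split=> //; apply: le_trans leE (posterior_subset _ _ _ (bigcup_sup j Pj)).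
Qed.

Lemma evident_level_le (R : realFieldType) (Omega : finType)
    (S : info_structure R Omega) (C E : {set Omega}) p q :
  0 <= q <= 1 -> evidence_level S C E p -> evident S C q E <-> q <= p.
Proof.
move=> q01 [_ Ep maxp]; split=> [|le_qp]; first exact: maxp.
exact: evident_le Ep.
Qed.

(** This removes the reference event: [E] can serve as its own. A superset of [E] with a level above
    [p] would be [p]-evident, hence contained in [E], hence equal to [E], which contradicts
    uniqueness of the level. *)
Lemma max_evident_eventP (R : realFieldType) (Omega : finType)
    (S : info_structure R Omega) (C E : {set Omega}) p :
  evidence_level S C E p ->
  max_evident_event S C E <-> largest_evident S C p E.
Proof.
move=> Ep; split=> [[F [_ [q [Eq largeE _]]]]|largeE].
  by rewrite (evidence_level_uniq Ep Eq).
exists E; split=> //; exists p; split=> // G q sEG Gq.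
have [//|lt_pq] := leP q p; have [_ Gevq _] := Gq.
have sGE : G \subset E by apply: largeE.2; apply: evident_le (ltW lt_pq) Gevq.
have eqEG : E = G by apply/eqP; rewrite eqEsubset sEG.
by rewrite eqEG in Ep; rewrite (evidence_level_uniq Ep Gq) ltxx in lt_pq.
Qed.

Theorem theorem1 (R : realFieldType) (Omega : finType)
    (S : info_structure R Omega) (C : {set Omega}) :
  exists s : seq {set Omega},
    [/\ forall E : {set Omega}, E \in s <-> max_evident_event S C E,
        forall i j : nat, (i < j)%N -> (j < size s)%N ->
          nth set0 s j \proper nth set0 s i
      & forall i : nat, (i.+1 < size s)%N ->
          largest_super_evident_subset S C (nth set0 s i) (nth set0 s i.+1)].
Proof.
have [lev levP] := fin_all_exists (evidence_level_exists S C).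
have lev01 E : 0 <= lev E <= 1 by have [] := levP E.
have evidentE E F : evident S C (lev E) F <-> lev E <= lev F.
  exact: evident_level_le (lev01 E) (levP F).
(* A boolean form of [largest_evident] at level [lev E], so that these events can be enumerated and
   sorted; [E] is evident at its own level automatically. *)
pose maxE E := [forall G : {set Omega}, (lev E <= lev G) ==> (G \subset E)].
have maxEP E : reflect (forall G, lev E <= lev G -> G \subset E) (maxE E).
  by apply: (iffP forallP) => H G; apply/implyP/H.
pose le_lev := relpre lev <=%R.
have le_lev_trans : transitive le_lev by move=> F E G; apply: le_trans.
pose s := sort le_lev (enum maxE).
have mem_s E : (E \in s) = maxE E by rewrite mem_sort mem_enum.
have sorted_s : sorted le_lev s by apply: sort_sorted => E F; apply: le_total.
have uniq_s : uniq s by rewrite sort_uniq enum_uniq.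
have maxE_nth i : (i < size s)%N -> maxE (nth set0 s i).
  by move=> lt_is; rewrite -mem_s mem_nth.
have le_nth i j : (i <= j)%N -> (j < size s)%N ->
    lev (nth set0 s i) <= lev (nth set0 s j).
  move=> le_ij lt_js; have lt_is := leq_ltn_trans le_ij lt_js.
  exact: (sorted_leq_nth le_lev_trans (fun E => lexx (lev E))).
have sub_nth i j : (i <= j)%N -> (j < size s)%N ->
    nth set0 s j \subset nth set0 s i.
  move=> le_ij lt_js; apply: (maxEP _ (maxE_nth _ _)); last exact: le_nth.
  exact: leq_ltn_trans lt_js.
have lt_nth i j : (i < j)%N -> (j < size s)%N ->
    lev (nth set0 s i) < lev (nth set0 s j).
  move=> lt_ij lt_js; have lt_is := ltn_trans lt_ij lt_js.
  (* With the levels reversed, the two events would contain each other, putting one event at two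
     positions of a duplicate-free list. *)
  rewrite ltNge; apply/negP => le_ji.
  have: nth set0 s i == nth set0 s j.
    by rewrite eqEsubset (sub_nth _ _ (ltnW lt_ij)) // (maxEP _ (maxE_nth _ _)).
  by rewrite nth_uniq // ltn_eqF.
exists s; split=> [E | i j lt_ij lt_js | i lt_i1s].
- rewrite mem_s; split=> [/maxEP maxEE|/(max_evident_eventP (levP E))[_ maxEE]].
    apply/(max_evident_eventP (levP E)).
    by split=> [|G /evidentE]; [apply/evidentE | apply: maxEE].
  by apply/maxEP => G /evidentE; apply: maxEE.
- rewrite properEneq (sub_nth _ _ (ltnW lt_ij)) // andbT.
  by rewrite nth_uniq ?gtn_eqF // (ltn_trans lt_ij).
split; first exact: sub_nth.
exists (lev (nth set0 s i)); split=> // [w wE k|G q _ Gq lt_Eq].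
  (* Super-evidence is evidence at the next event's own level, which is strictly higher. *)
  have [_ Eev _] := levP (nth set0 s i.+1).
  by have [] := Eev w wE k; split; apply: lt_le_trans (lt_nth i i.+1 _ _) _.
rewrite (evidence_level_uniq Gq (levP G)) in lt_Eq.
pose U := \bigcup_(H | lev G <= lev H) H.
have le_GU : lev G <= lev U.
  by apply/evidentE; apply: evident_bigcup => H /evidentE.
have sU : U \in s.
  rewrite mem_s; apply/maxEP => H le_UH.
  (* Any [H] of level at least [lev U] also has level at least [lev G], so it is one of the sets
     united in [U]. *)
  exact/bigcup_sup/(le_trans le_GU).
apply: (@subset_trans _ _ U); first exact: (bigcup_sup G).
have ltUs : (index U s < size s)%N by rewrite index_mem.
(* Were [U] at position [i] or earlier, its level would be at most that of the event at [i], hence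
   below [lev G <= lev U]. *)
rewrite -(nth_index set0 sU) sub_nth // ltnNge; apply/negP => le_Ui.
have := lt_le_trans lt_Eq le_GU.
by rewrite -{1}(nth_index set0 sU) ltNge le_nth // ltnW.
Qed.
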